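(* There exists a constant $C(n)$ depending only on $n=\dim M$ such that the following holds. Suppose $g_0,g_1\in\mathcal{M}$, and let $E:=\{x\in M: g_0(x)\neq g_1(x)\}$. Then $$d(g_0,g_1)\le C(n)\left(\sqrt{\mathrm{Vol}(E,g_0)}+\sqrt{\mathrm{Vol}(E,g_1)}\right).$$ In particular, for every $\delta>0$, the diameter with respect to $d$ satisfies $$\mathrm{diam}\left(\{\tilde g\in\mathcal{M}: \mathrm{Vol}(M,\tilde g)\le\delta\}\right)\le 2C(n)\sqrt{\delta}.$$
   Context: $M$ is a closed, orientable, $n$-dimensional $C^\infty$ manifold. $\mathcal{S}$ is the Fréchet space of smooth symmetric $(0,2)$-tensor fields on $M$ and $\mathcal{M}\subset\mathcal{S}$ the open subset of smooth Riemannian metrics, so $T_{\tilde g}\mathcal{M}\cong\mathcal{S}$. The $L^2$ metric on $\mathcal{M}$ is the weak Riemannian metric $(h,k)_{\tilde g}=\int_M \mathrm{tr}(\tilde g^{-1}h\tilde g^{-1}k)\,d\mu_{\tilde g}$, where $\mu_{\tilde g}$ is the volume form of $\tilde g$; $d$ is its distance function, i.e. $d(g_0,g_1)$ is the infimum of the lengths of paths in $\mathcal{M}$ from $g_0$ to $g_1$. $\mathrm{Vol}(Y,\tilde g)=\int_Y d\mu_{\tilde g}$ for measurable $Y\subseteq M$. *)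

(* Defs.v *)
From HB Require Import structures.
From mathcomp Require Import all_boot all_order all_algebra.
From mathcomp Require Import all_classical all_reals all_analysis.

Set Implicit Arguments.
Unset Strict Implicit.
Unset Printing Implicit Defensive.

Import Order.TTheory GRing.Theory Num.Theory.
Import numFieldNormedType.Exports.

Local Open Scope classical_set_scope.
Local Open Scope ring_scope.

(** * Lebesgue measure on R^n

    The n-fold product of the one-dimensional Lebesgue measure, on the product
    sigma-algebra of [n.-tuple R]. *)

Section lebesgue_succ.
Context {R : realType} {n : nat}.
Local Notation RR := (measurableTypeR R).
Variable m : {sigma_finite_measure set (n.-tuple RR) -> \bar R}.

Definition tuple_cons (p : RR * n.-tuple RR) : n.+1.-tuple RR :=
  [tuple of p.1 :: p.2].

Let measurable_tuple_cons : measurable_fun [set: RR * n.-tuple RR] tuple_cons.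
Proof. exact: measurable_cons measurable_fst measurable_snd. Qed.

Definition lebesgue_succ : set (n.+1.-tuple RR) -> \bar R :=
  pushforward (lebesgue_measure \x m)%E tuple_cons.

HB.instance Definition _ := Measure.copy lebesgue_succ
  (measure_function_pushforward__canonical__measure_function_Measure
     (lebesgue_measure \x m)%E measurable_tuple_cons).

Let sigma_finite_lebesgue_succ : sigma_finite setT lebesgue_succ.
Proof.
have /sigma_finiteP[F [FT ndF Foo]] := sigma_finiteT (@lebesgue_measure R).
have /sigma_finiteP[G [GT ndG Goo]] := sigma_finiteT m.
pose uncons (t : n.+1.-tuple RR) : RR * n.-tuple RR :=
  (tnth t ord0, [tuple of behead t]).
have consK : cancel tuple_cons uncons.
  by move=> [x t]; rewrite /uncons /=; congr (_, _); exact: val_inj.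
have munc : measurable_fun [set: n.+1.-tuple RR] uncons.
  by apply: measurable_fun_pair; [exact: measurable_tnth|exact: measurable_behead].
exists (fun k => uncons @^-1` (F k `*` G k)).
  apply/seteqP; split => // t _.
  have [i _ Fi] : (\bigcup_i F i) (uncons t).1 by rewrite -FT.
  have [j _ Gj] : (\bigcup_i G i) (uncons t).2 by rewrite -GT.
  exists (maxn i j) => //; split.
    by move: Fi; exact/subsetPset/ndF/leq_maxl.
  by move: Gj; exact/subsetPset/ndG/leq_maxr.
move=> k; have [mF Fkoo] := Foo k; have [mG Gkoo] := Goo k; split.
  by rewrite -[X in measurable X]setTI; apply: munc => //; exact: measurableX.
rewrite /lebesgue_succ /pushforward -comp_preimage.
rewrite (_ : uncons \o tuple_cons = id); last by apply/funext => p; exact: consK.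
by rewrite preimage_id product_measure1E// lte_mul_pinfty// ge0_fin_numE.
Qed.

HB.instance Definition _ := Measure_isSigmaFinite.Build _ _ _
  lebesgue_succ sigma_finite_lebesgue_succ.

End lebesgue_succ.

Section lebesgue_zero.
Context {R : realType}.
Local Notation RR := (measurableTypeR R).

Definition lebesgue_zero : set (0.-tuple RR) -> \bar R := dirac [tuple].

HB.instance Definition _ := Measure.on lebesgue_zero.

Let sigma_finite_lebesgue_zero : sigma_finite setT lebesgue_zero.
Proof.
by apply: fin_num_fun_sigma_finite; rewrite ?measure0// => A mA;
   rewrite /lebesgue_zero diracE.
Qed.

HB.instance Definition _ := Measure_isSigmaFinite.Build _ _ _
  lebesgue_zero sigma_finite_lebesgue_zero.

End lebesgue_zero.

Fixpoint lebesgue_Rn (R : realType) (n : nat) :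
    {sigma_finite_measure set (n.-tuple (measurableTypeR R)) -> \bar R} :=
  match n with
  | 0 => lebesgue_zero
  | n'.+1 => lebesgue_succ (lebesgue_Rn R n')
  end.

Definition vec (R : realType) (n : nat) (t : n.-tuple (measurableTypeR R)) :
  'rV[R]_n := \row_i tnth t i.

(** * Smooth functions on open subsets of R^n *)

(** [partials f [:: i1; ...; ik]] is the iterated partial derivative
    d_i1 (d_i2 (... (d_ik f))). *)
Definition partials (R : realType) (n : nat) (f : 'rV[R]_n -> R)
    (s : seq 'I_n) : 'rV[R]_n -> R :=
  foldr (fun i h => 'D_(delta_mx 0 i) h) f s.

(** Meant for open [W]: all partial derivatives of all orders exist and are
    continuous on [W]. *)
Definition smooth_on (R : realType) (n : nat) (W : set 'rV[R]_n)
    (f : 'rV[R]_n -> R) : Prop :=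
  forall (s : seq 'I_n) (y : 'rV[R]_n), W y ->
    {for y, continuous (partials f s)} /\
    forall i : 'I_n, derivable (partials f s) y (delta_mx 0 i).

(** * Closed manifolds *)

(** The values of [cmap] outside [cdom], and of [cinv] outside
    [ccodom], are irrelevant. *)
Record chart (R : realType) (n : nat) (M : topologicalType) := Chart {
  cdom : set M;
  cmap : M -> 'rV[R]_n;
  cinv : 'rV[R]_n -> M;
  cdom_open : open cdom;
  ccodom_open : open (cmap @` cdom);
  cmapK : forall x, cdom x -> cinv (cmap x) = x;
  cmap_continuous : forall x, cdom x -> {for x, continuous cmap};
  cinv_continuous : forall y, (cmap @` cdom) y -> {for y, continuous cinv}
}.

Definition ccodom (R : realType) (n : nat) (M : topologicalType)
  (c : chart R n M) : set 'rV[R]_n := cmap c @` cdom c.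

Definition transition (R : realType) (n : nat) (M : topologicalType)
  (c c' : chart R n M) : 'rV[R]_n -> 'rV[R]_n := cmap c' \o cinv c.

Definition smooth_transition (R : realType) (n : nat) (M : topologicalType)
    (c c' : chart R n M) : Prop :=
  forall j : 'I_n, smooth_on (cmap c @` (cdom c `&` cdom c'))
                             (fun y => transition c c' y 0 j).

(** A compact manifold without boundary: its smooth structure is generated by
    some finite atlas.  Second countability follows from that. *)
Record closed_manifold (R : realType) (n : nat) := ClosedManifold {
  space :> topologicalType;
  space_hausdorff : hausdorff_space space;
  space_compact : compact [set: space];
  atlas_size : nat;
  atlas : 'I_atlas_size -> chart R n space;
  atlas_cover : forall x : space, exists i, cdom (atlas i) x;
  atlas_smooth : forall i j, smooth_transition (atlas i) (atlas j)
}.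

Arguments atlas {R n} c _.

(** There is an atlas of the smooth structure, possibly other than [atlas M],
    all of whose transition maps have positive Jacobian determinant. *)
Definition orientable (R : realType) (n : nat) (M : closed_manifold R n) :
    Prop :=
  exists O : set (chart R n M),
    [/\ forall x : M, exists2 c, O c & cdom c x,
        forall c, O c -> forall i,
          smooth_transition c (atlas M i) /\ smooth_transition (atlas M i) c
      & forall c c', O c -> O c' -> forall x, cdom c x -> cdom c' x ->
          0 < \det (jacobian (transition c c') (cmap c x))].

Section geometry.
Context {R : realType} {n : nat} (M : closed_manifold R n).
Local Notation N := (@atlas_size R n M).

(** * Tensor fields and metrics *)

(** A (0,2)-tensor field is given by its matrices of components: [h i x] is
    the matrix, in the coordinates of the [i]-th chart, of the bilinear form
    at [x]; it is irrelevant when [x] is outside the domain of that chart. *)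
Definition field := 'I_N -> M -> 'M[R]_n.

Definition component (h : field) (i : 'I_N) (a b : 'I_n) : 'rV[R]_n -> R :=
  fun y => h i (cinv (atlas M i) y) a b.

(** MathComp matrices act on row vectors on the right, so the Jacobian here
    is the transpose of the usual one. *)
Definition sym_tensor (h : field) : Prop :=
  [/\ forall i x, cdom (atlas M i) x -> (h i x)^T = h i x,
      forall i j x, cdom (atlas M i) x -> cdom (atlas M j) x ->
        let J := jacobian (transition (atlas M i) (atlas M j))
                          (cmap (atlas M i) x) in
        h i x = J *m h j x *m J^T
    & forall i a b, smooth_on (ccodom (atlas M i)) (component h i a b)].

Definition metric (g : field) : Prop :=
  sym_tensor g /\
  forall i x, cdom (atlas M i) x ->
    forall v : 'rV[R]_n, v != 0 -> 0 < (v *m g i x *m v^T) 0 0.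

Definition diff_set (g0 g1 : field) : set M :=
  [set x | exists i, cdom (atlas M i) x /\ g0 i x <> g1 i x].

(** * Integration against the Riemannian volume *)

(** The pieces form a measurable partition of [M], each inside one chart. *)
Definition piece (i : 'I_N) : set M :=
  [set x | cdom (atlas M i) x /\
           forall j : 'I_N, (j < i)%N -> ~ cdom (atlas M j) x].

(** The integral over [Y] of the function on [M] whose expression in the
    [i]-th chart is [F i]. *)
Definition integral_vol (g : field) (Y : set M) (F : 'I_N -> M -> R) : \bar R :=
  (\sum_(i < N)
    \int[lebesgue_Rn R n]_(t in
          [set t | (cmap (atlas M i) @` (Y `&` piece i)) (vec t)])
      (let x := cinv (atlas M i) (vec t) in
       F i x * Num.sqrt (\det (g i x)))%:E)%E.

Definition Vol (Y : set M) (g : field) : \bar R :=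
  integral_vol g Y (fun _ _ => 1).

(** * The L^2 metric and its distance *)

Definition L2 (g h k : field) : \bar R :=
  integral_vol g setT
    (fun i x => \tr (invmx (g i x) *m h i x *m invmx (g i x) *m k i x)).

(** Convergence in the Frechet space of smooth tensor fields: uniform
    convergence of all partial derivatives of all components on compact
    subsets of the charts. *)
Definition cvg_field (T : Type) (F : set_system T) (h : T -> field)
    (l : field) : Prop :=
  forall (i : 'I_N) (a b : 'I_n) (s : seq 'I_n) (K : set 'rV[R]_n) (e : R),
    compact K -> K `<=` ccodom (atlas M i) -> 0 < e ->
    \forall t \near F, forall y, K y ->
      `|partials (component (h t) i a b) s y -
        partials (component l i a b) s y| < e.

(** [gamma], restricted to [a, b], is a C^1 path of metrics with derivative
    [gamma']; derivatives at the endpoints are one-sided. *)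
Definition C1_path (a b : R) (gamma gamma' : R -> field) : Prop :=
  forall t, t \in `[a, b] ->
    [/\ metric (gamma t),
        sym_tensor (gamma' t),
        cvg_field (within `[a, b] t^')
          (fun u i x => (u - t)^-1 *: (gamma u i x - gamma t i x)) (gamma' t)
      & cvg_field (within `[a, b] (nbhs t)) gamma' (gamma' t)].

Definition length_C1 (a b : R) (gamma gamma' : R -> field) : \bar R :=
  (\int[lebesgue_measure]_(t in `[a, b])
    sqrte (L2 (gamma t) (gamma' t) (gamma' t)))%E.

(** A piecewise C^1 path on [0, 1]: [ts] lists the breakpoints, starting
    after 0 and ending with 1, and [v k] is the derivative on the [k]-th
    subinterval. *)
Definition piecewise_C1_path (gamma : R -> field) (ts : seq R)
    (v : nat -> R -> field) : Prop :=
  [/\ path <%R 0 ts, last 0 ts = 1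
    & forall k, (k < size ts)%N ->
        C1_path (nth 0 (0 :: ts) k) (nth 0 ts k) gamma (v k)].

Definition path_length (gamma : R -> field) (ts : seq R) (v : nat -> R -> field) :
    \bar R :=
  (\sum_(k < size ts)
     length_C1 (nth 0%R (0%R :: ts) k) (nth 0%R ts k) gamma (v k))%E.

Definition L2_dist (g0 g1 : field) : \bar R :=
  ereal_inf [set l | exists gamma ts v,
    [/\ piecewise_C1_path gamma ts v, gamma 0 = g0, gamma 1 = g1
      & l = path_length gamma ts v]].

Definition diam (A : set field) : \bar R :=
  ereal_sup [set d | exists g0 g1, [/\ A g0, A g1 & d = L2_dist g0 g1]].

End geometry.

(* Main.v *)
Require Import Defs.
From mathcomp Require Import all_boot all_order all_algebra all_fingroup.
From mathcomp Require Import all_classical all_reals all_analysis.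
From mathcomp Require Import ring lra.

(** Write [h = g1 - g0]; it vanishes off [E].  The distance is bounded by the
    length of an explicit detour made of three legs.

    Choose a smooth function [rho] on M with values in ]0, 1], equal to 1 off
    [E].  The detour shrinks [g0] to [rho ^ 4 g0], crosses along the segment
    from [rho ^ 4 g0] to [rho ^ 4 g1], and expands [rho ^ 4 g1] to [g1].

    Shrinking is cheap.  For a path [p ^ 4 g] with [p] affine in time, the
    squared speed is the integral of [16 n p' ^ 2 p ^ (2 n - 2)] against the
    volume of [g].  As [0 < p <= 1], and [p' = 0] off [E], this is at most a
    constant times [Vol E g], however small [rho] may be
    ([scaling_length_le]).

    Crossing is cheap when [rho] is small.  Multiplying both metrics of a
    segment by [rho ^ 4] multiplies the energy density of [h] by
    [rho ^ (2 n)].  At the metric [gt = g0 + t h] that density, relative to the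
    volume of [g0], is at most

      [excess = 4 (s0 + s1) n! (2 + s0) ^ n],

    where [s0] and [s1] are the squared norms of [h] for [g0] and [g1]
    ([segment_energy_le]): the trace is controlled because [gt >= g0 / 2] for
    [t <= 1/2] and [gt >= g1 / 2] for [t >= 1/2], the volume density because the
    entries of [gt] in a [g0]-orthonormal basis are at most [2 + s0].  The
    function [excess] is smooth on M and vanishes off [E], so
    [rho = 1 / (1 + excess)] is an admissible choice, for which the crossing has
    energy density at most [excess / (1 + excess) <= 1] on [E] and 0 elsewhere.

    The bound on the diameter follows, as [Vol E g <= Vol M g].

    All densities are compared pointwise; since the integral of a nonnegative
    function is the supremum of those of the simple functions below it, pointwise
    bounds integrate directly ([integral_le_scaled]).

    It remains to see that the detour is C^1.  Each leg is a polynomial in time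
    whose coefficients are smooth tensor fields, so this reduces to the
    convergence of finitely many real coefficients ([C1_path_poly]).  The
    smoothness of these coefficients comes from the stability of smooth
    functions under ring operations and inverses ([smooth_exprP]).  Their
    compatibility on overlaps of charts is algebraic: a change of coordinates acts
    on metrics and tensors by a congruence, which leaves the traces invariant
    ([sqnorm_congr]). *)

Set Implicit Arguments.
Unset Strict Implicit.
Unset Printing Implicit Defensive.

Import Order.TTheory GRing.Theory Num.Theory.
Import numFieldNormedType.Exports.

Local Open Scope classical_set_scope.
Local Open Scope ring_scope.

(** * Norms of symmetric forms with respect to a positive definite form *)

Definition posdef (R : numDomainType) (n : nat) (A : 'M[R]_n) : Prop :=
  A^T = A /\ forall v : 'rV[R]_n, v != 0 -> 0 < (v *m A *m v^T) 0 0.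

(** The squared norm of a symmetric form [h] for the inner product that [g]
    induces on tensors: the integrand of the L^2 metric. *)
Definition sqnorm (R : comUnitRingType) (n : nat) (g h : 'M[R]_n) : R :=
  \tr (invmx g *m h *m invmx g *m h).

(** The norm does not depend on the basis in which both forms are written.  This
    makes it a function on the manifold, and lets estimates be proved in a basis
    where [g] is the identity. *)
Lemma sqnorm_congr (R : comUnitRingType) (n : nat) (J g h : 'M[R]_n) :
  J \in unitmx -> g \in unitmx ->
  sqnorm (J *m g *m J^T) (J *m h *m J^T) = sqnorm g h.
Proof.
move=> uJ ug; have uJT : J^T \in unitmx by rewrite unitmx_tr.
have invE : invmx (J *m g *m J^T) = invmx J^T *m invmx g *m invmx J.
  have uJgJ : J *m g *m J^T \in unitmx by rewrite !unitmx_mul uJ ug uJT.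
  apply: (can_inj (mulKmx uJgJ)); rewrite mulmxV// !mulmxA.
  rewrite -(mulmxA (J *m g)) mulmxV// mulmx1 -(mulmxA J) mulmxV// mulmx1.
  by rewrite mulmxV.
rewrite /sqnorm invE !mulmxA -(mulmxA _ (invmx J)) mulVmx// mulmx1.
rewrite -(mulmxA _ J^T) mulmxV// mulmx1 -(mulmxA _ (invmx J)) mulVmx// mulmx1.
by rewrite mxtrace_mulC !mulmxA mulmxV// mul1mx.
Qed.

Lemma sqnorm1 (R : comUnitRingType) (n : nat) (S : 'M[R]_n) :
  S^T = S -> sqnorm 1%:M S = \sum_i \sum_j S i j ^+ 2.
Proof.
move=> symS; rewrite /sqnorm invmx1 !mul1mx mulmx1 /mxtrace.
apply: eq_bigr => i _; rewrite mxE; apply: eq_bigr => j _.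
by rewrite -{2}symS mxE expr2.
Qed.

Lemma sqnormZ (R : fieldType) (n : nat) (c d : R) (g h : 'M[R]_n) :
  c != 0 -> g \in unitmx ->
  sqnorm (c *: g) (d *: h) = (d / c) ^+ 2 * sqnorm g h.
Proof.
move=> c0 ug; have ucg : c *: g \in unitmx by rewrite unitmxZ// unitfE.
rewrite /sqnorm invmxZ// -!(scalemxAl, scalemxAr) !scalerA mxtraceZ.
by congr (_ * _); field.
Qed.

(** Cholesky decomposition: clearing the first row and column leaves the Schur
    complement, which is again positive definite. *)
Lemma posdef_factor (R : rcfType) (n : nat) (A : 'M[R]_n) :
  posdef A -> exists2 P : 'M[R]_n, P \in unitmx & A = P *m P^T.
Proof.
elim: n A => [|n IH] A [symA posA].
  by exists 1%:M; [exact: unitmx1|rewrite !flatmx0].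
pose a := A 0 0.
pose b := dlsubmx (A : 'M[R]_(1 + n)).
pose C := drsubmx (A : 'M[R]_(1 + n)).
have ulE : ulsubmx (A : 'M[R]_(1 + n)) = a%:M.
  rewrite [LHS]mx11_scalar; congr (_%:M); rewrite !mxE.
  by congr (A _ _); apply/val_inj.
have urE : ursubmx (A : 'M[R]_(1 + n)) = b^T.
  by rewrite /b trmx_dlsub symA.
have symC : C^T = C by rewrite /C trmx_drsub symA.
have AE : A = block_mx a%:M b^T b C :> 'M[R]_(1 + n).
  by rewrite -ulE -urE submxK.
have a0 : 0 < a.
  have /posA : delta_mx 0 0 != 0 :> 'rV[R]_(n.+1).
    by apply/eqP => /matrixP/(_ 0 0)/eqP; rewrite !mxE !eqxx/= oner_eq0.
  by rewrite -rowE trmx_delta -colE !mxE.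
have s0 : Num.sqrt a != 0 by rewrite gt_eqF// sqrtr_gt0.
have ss : Num.sqrt a * Num.sqrt a = a by rewrite -expr2 sqr_sqrtr ?ltW.
have [|Q uQ QE] := IH (C - a^-1 *: (b *m b^T)).
  split; first by rewrite linearB linearZ /= trmx_mul trmxK symC.
  move=> v v0.
  (* [u] minimises the form of [A] over the vectors [(u, v)]; the minimum is
     the Schur complement at [v]. *)
  pose u : 'rV[R]_1 := - a^-1 *: (v *m b).
  have w0 : row_mx u v != 0 :> 'rV[R]_(1 + n).
    by apply: contra_neq v0 => w0; rewrite -(row_mxKr u v) w0 linear0.
  have : 0 < (row_mx u v *m block_mx a%:M b^T b C *m (row_mx u v)^T) 0 0.
    by rewrite -AE; exact: posA.
  rewrite mul_row_block.
  suff -> : row_mx (u *m a%:M + v *m b) (u *m b^T + v *m C) =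
            row_mx 0 (v *m (C - a^-1 *: (b *m b^T))).
    by rewrite tr_row_mx mul_row_col mul0mx add0r.
  congr row_mx.
    by rewrite mul_mx_scalar scalerA mulrN divff ?gt_eqF// scaleN1r addNr.
  by rewrite mulmxBr -scalemxAr mulmxA /u -scalemxAl scaleNr addrC.
pose L : 'M[R]_(1 + n) := block_mx (Num.sqrt a)%:M 0 ((Num.sqrt a)^-1 *: b) Q.
have uL : L \in unitmx.
  by rewrite unitmxE det_lblock det_scalar expr1 unitrM unitfE s0 -unitmxE.
exists L; first exact: uL.
suff LE : block_mx a%:M b^T b C = L *m L^T by rewrite AE LE.
rewrite tr_block_mx mulmx_block !tr_scalar_mx !trmx0 !mul0mx !mulmx0 !addr0.
congr block_mx.
- by rewrite -scalar_mxM ss.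
- by rewrite mul_scalar_mx linearZ /= scalerA divff// scale1r.
- by rewrite mul_mx_scalar scalerA divff// scale1r.
- rewrite -QE linearZ /= -scalemxAl -scalemxAr scalerA -invfM ss addrC.
  by rewrite subrK.
Qed.

Section posdef_theory.
Variables (R : rcfType) (n : nat).
Implicit Types g h A : 'M[R]_n.

Lemma posdef_unit A : posdef A -> A \in unitmx.
Proof.
by move=> /posdef_factor[P uP ->]; rewrite unitmx_mul unitmx_tr uP.
Qed.

Lemma posdef_det A : posdef A -> 0 < \det A.
Proof.
move=> /posdef_factor[P uP ->]; rewrite det_mulmx det_tr -expr2 exprn_even_gt0//=.
by rewrite -unitfE -unitmxE.
Qed.

Lemma posdef_congr A (J : 'M[R]_n) :
  J \in unitmx -> posdef A -> posdef (J *m A *m J^T).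
Proof.
move=> uJ [symA posA]; split; first by rewrite !trmx_mul trmxK symA mulmxA.
move=> v v0; have := posA (v *m J); rewrite trmx_mul !mulmxA; apply.
by apply: contra_neq v0 => vJ0; rewrite -(mulmxK uJ v) vJ0 mul0mx.
Qed.

Lemma posdefD A B : posdef A -> posdef B -> posdef (A + B).
Proof.
move=> [sA pA] [sB pB]; split; first by rewrite linearD /= sA sB.
by move=> v v0; rewrite mulmxDr mulmxDl mxE addr_gt0 ?pA ?pB.
Qed.

Lemma posdefZ (c : R) A : 0 < c -> posdef A -> posdef (c *: A).
Proof.
move=> c0 [sA pA]; split; first by rewrite linearZ /= sA.
by move=> v v0; rewrite -scalemxAr -scalemxAl mxE mulr_gt0// pA.
Qed.

Lemma posdef_ge0 A (v : 'rV[R]_n) : posdef A -> 0 <= (v *m A *m v^T) 0 0.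
Proof.
move=> [_ pA]; have [->|/pA/ltW//] := eqVneq v 0.
by rewrite !mul0mx mxE.
Qed.


Lemma posdef_segment A B (t : R) : 0 <= t <= 1 -> posdef A -> posdef B ->
  posdef (A + t *: (B - A)).
Proof.
move=> /andP[t0 t1] pA pB.
have -> : A + t *: (B - A) = (1 - t) *: A + t *: B.
  by rewrite scalerBr scalerBl scale1r addrA addrAC.
move: t0; rewrite le_eqVlt => /predU1P[<-|t0].
  by rewrite subr0 scale0r addr0 scale1r.
move: t1; rewrite le_eqVlt => /predU1P[->|t1].
  by rewrite subrr scale0r add0r scale1r.
by apply: posdefD; apply: posdefZ; rewrite ?subr_gt0.
Qed.

Lemma sqnorm_ge0 g h : posdef g -> h^T = h -> 0 <= sqnorm g h.
Proof.
move=> /posdef_factor[P uP ->] symh.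
have -> : h = P *m (invmx P *m h *m invmx P^T) *m P^T.
  by rewrite !mulmxA mulmxV// mul1mx mulmxKV// unitmx_tr.
rewrite -{1}[P]mulmx1 sqnorm_congr ?unitmx1// sqnorm1.
  by apply: sumr_ge0 => i _; apply: sumr_ge0 => j _; exact: sqr_ge0.
by rewrite !trmx_mul !trmx_inv trmxK symh mulmxA.
Qed.

(** With [Z = S A^-1], the left side is [tr (Z Z) <= tr (Z Z^T)], the sum of the
    squared lengths of the rows [z] of [Z].  Each satisfies [z A = s], the
    corresponding row of [S], so that [c |z|^2 <= z A z^T = s z^T <= |s| |z|]. *)
Lemma sqnorm_le1 A S (c : R) : posdef A -> S^T = S -> 0 < c ->
  (forall v : 'rV[R]_n, c * (v *m v^T) 0 0 <= (v *m A *m v^T) 0 0) ->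
  sqnorm A S <= c ^- 2 * sqnorm 1%:M S.
Proof.
move=> pA symS c0 cA; pose Z := S *m invmx A.
have uA := posdef_unit pA.
have ZA : Z *m A = S by rewrite mulmxKV.
have -> : sqnorm A S = \tr (Z *m Z).
  by rewrite /sqnorm mxtrace_mulC !mulmxA.
move: Z ZA => Z ZA.
rewrite sqnorm1//; apply: (@le_trans _ _ (\sum_i \sum_j Z i j ^+ 2)).
  have -> : \sum_i \sum_j Z i j ^+ 2 =
            2^-1 * \sum_i \sum_j (Z i j ^+ 2 + Z j i ^+ 2).
    under [in RHS]eq_bigr do rewrite big_split/=.
    rewrite big_split/= [X in _ * (_ + X)]exchange_big/=.
    by rewrite -mulr2n -[X in _ * X]mulr_natl mulrA mulVf ?mul1r ?pnatr_eq0.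
  rewrite mulr_sumr; apply: ler_sum => i _; rewrite mxE mulr_sumr.
  apply: ler_sum => j _; have := sqr_ge0 (Z i j - Z j i); rewrite sqrrB; lra.
rewrite mulr_sumr; apply: ler_sum => i _.
pose z := row i Z; pose s := row i S.
have zE : (z *m z^T) 0 0 = \sum_j Z i j ^+ 2.
  by rewrite mxE; apply: eq_bigr => j _; rewrite !mxE expr2.
have zs : z *m A = s by rewrite /z /s -row_mul ZA.
have := cA z; rewrite zs zE; set a := \sum_j _ => cas.
set b := \sum_j _.
(* Young's inequality, in place of Cauchy-Schwarz. *)
suff : c * a <= c / 2 * a + (2 * c)^-1 * b.
  move=> cab; have {cab} cab : c / 2 * a <= (2 * c)^-1 * b by lra.
  have := ler_wpM2l (_ : 0 <= 2 / c) cab; rewrite divr_ge0 ?(ltW c0)//.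
  move=> /(_ isT).
  have -> : 2 / c * (c / 2 * a) = a by field; rewrite gt_eqF.
  by have -> : 2 / c * ((2 * c)^-1 * b) = c ^- 2 * b by field; rewrite gt_eqF.
apply: (le_trans cas); rewrite mxE !mulr_sumr -big_split/=.
apply: ler_sum => j _; rewrite !mxE.
have := sqr_ge0 (c * Z i j - S i j); set x := Z i j; set y := S i j => xy.
rewrite -subr_ge0.
have -> : c / 2 * x ^+ 2 + (2 * c)^-1 * y ^+ 2 - y * x =
          (2 * c)^-1 * (c * x - y) ^+ 2 by field; rewrite gt_eqF.
by rewrite mulr_ge0// invr_ge0 mulr_ge0// ltW.
Qed.

(** The previous bound in an orthonormal basis of [g]. *)
Lemma sqnorm_le g A h (c : R) : posdef g -> posdef A -> h^T = h -> 0 < c ->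
  (forall v : 'rV[R]_n, c * (v *m g *m v^T) 0 0 <= (v *m A *m v^T) 0 0) ->
  sqnorm A h <= c ^- 2 * sqnorm g h.
Proof.
move=> /posdef_factor[P uP ->] pA symh c0 cA.
have uPT : P^T \in unitmx by rewrite unitmx_tr.
have PK (X : 'M[R]_n) : X = P *m (invmx P *m X *m (invmx P)^T) *m P^T.
  by rewrite trmx_inv !mulmxA mulmxV// mul1mx mulmxKV.
set B := invmx P *m A *m (invmx P)^T; set S := invmx P *m h *m (invmx P)^T.
have pB : posdef B by apply: posdef_congr => //; rewrite unitmx_inv.
have symS : S^T = S by rewrite /S !trmx_mul trmxK symh mulmxA.
have P1 : P *m P^T = P *m 1%:M *m P^T by rewrite mulmx1.
rewrite (PK A) (PK h) -/B -/S P1.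
rewrite !(sqnorm_congr _ uP) ?unitmx1 ?(posdef_unit pB)//.
apply: sqnorm_le1 => // v.
have := cA (v *m invmx P); rewrite !trmx_mul !mulmxA mulmxKV//.
by rewrite -(mulmxA v P^T) trmx_inv mulmxV// mulmx1.
Qed.

Lemma det_le A (m : R) :
  (forall i j, `|A i j| <= m) -> \det A <= n`!%:R * m ^+ n.
Proof.
move=> Am; apply: (le_trans (ler_norm _)).
apply: (le_trans (ler_norm_sum _ _ _)).
apply: (@le_trans _ _ (\sum_(s : 'S_n) m ^+ n)); last first.
  by rewrite sumr_const card_Sn mulr_natl.
apply: ler_sum => s _; rewrite normrM normrX normrN1 expr1n mul1r normr_prod.
rewrite -[X in m ^+ X]card_ord -prodr_const.
by apply: ler_prod => i _; rewrite normr_ge0/=.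
Qed.

(** Bounds the determinant of an n x n matrix whose entries have absolute value at
    most [2 + s]. *)
Definition detbound (s : R) : R := n`!%:R * (2 + s) ^+ n.

Lemma detbound_ge1 s : 0 <= s -> 1 <= detbound s.
Proof.
move=> s0; rewrite -[1]mulr1 ler_pM// ?ler1n ?fact_gt0//.
by apply: exprn_ege1; lra.
Qed.

(** In an orthonormal basis of [g], where [h] becomes a symmetric [S], every
    entry of [1 + t S] is at most [1 + (1 + S i j ^ 2)]. *)
Lemma det_segment_le g h (t : R) : posdef g -> h^T = h -> 0 <= t <= 1 ->
  \det (g + t *: h) <= detbound (sqnorm g h) * \det g.
Proof.
move=> /posdef_factor[P uP ->] symh /andP[t0 t1].
have uPT : P^T \in unitmx by rewrite unitmx_tr.
have PK (X : 'M[R]_n) : X = P *m (invmx P *m X *m (invmx P)^T) *m P^T.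
  by rewrite trmx_inv !mulmxA mulmxV// mul1mx mulmxKV.
set S := invmx P *m h *m (invmx P)^T.
have symS : S^T = S by rewrite /S !trmx_mul trmxK symh mulmxA.
have P1 : P *m P^T = P *m 1%:M *m P^T by rewrite mulmx1.
rewrite (PK h) -/S P1 sqnorm_congr ?unitmx1//.
rewrite scalemxAl scalemxAr -mulmxDl -mulmxDr !det_mulmx det1 mulr1 det_tr.
rewrite mulrAC [leRHS]mulrC ler_wpM2l//; first by rewrite -expr2 sqr_ge0.
clearbody S; apply: det_le => i j; rewrite sqnorm1//.
set s := \sum_i _.
have sij : S i j ^+ 2 <= s.
  rewrite /s (bigD1 i)//= (bigD1 j)//= -addrA lerDl.
  rewrite addr_ge0// sumr_ge0// => k _; rewrite ?sqr_ge0//.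
  by rewrite sumr_ge0// => *; rewrite sqr_ge0.
rewrite !mxE; apply: (le_trans (ler_normD _ _)).
rewrite normrM (ger0_norm t0).
have : `|S i j| <= 1 + s.
  apply: le_trans (lerD (lexx 1) sij); rewrite -real_normK ?num_real//.
  by have := sqr_ge0 (`|S i j| - 1); have := sqr_ge0 `|S i j|; rewrite sqrrB1; lra.
have : t * `|S i j| <= `|S i j| by rewrite ler_piMl.
have : `|(i == j)%:R| <= 1 :> R by case: (i == j); rewrite ?normr1 ?normr0.
lra.
Qed.

(** Along a segment of metrics, the energy density of the velocity is bounded by
    a rational expression in the endpoints.  The segment stays above [A / 2]
    during its first half and above [B / 2] during the second; each half
    contributes one of the two norms. *)
Lemma segment_energy_le A B (t : R) (h := B - A) :
  posdef A -> posdef B -> 0 <= t <= 1 ->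
  sqnorm (A + t *: h) h * Num.sqrt (\det (A + t *: h)) <=
  4 * (sqnorm A h + sqnorm B h) * detbound (sqnorm A h) * Num.sqrt (\det A).
Proof.
move=> pA pB t01; have pt := posdef_segment t01 pA pB; rewrite -/h in pt.
have symh : h^T = h by rewrite /h linearB /= pA.1 pB.1.
have sA0 := sqnorm_ge0 pA symh; have sB0 := sqnorm_ge0 pB symh.
have d1 := detbound_ge1 sA0.
have vE (v : 'rV[R]_n) : (v *m (A + t *: h) *m v^T) 0 0 =
    (1 - t) * (v *m A *m v^T) 0 0 + t * (v *m B *m v^T) 0 0.
  rewrite /h mulmxDr -scalemxAr mulmxBr mulmxDl -scalemxAl mulmxBl !mxE.
  by ring.
rewrite -[leRHS]mulrA ler_pM ?sqnorm_ge0 ?sqrtr_ge0//.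
  have [t2|t2] := leP t 2^-1.
    apply: (@le_trans _ _ (2^-1 ^- 2 * sqnorm A h)).
      apply: sqnorm_le; rewrite ?invr_gt0// => v; rewrite vE.
      have := posdef_ge0 v pA; have := posdef_ge0 v pB; nra.
    by rewrite exprVn invrK; lra.
  apply: (@le_trans _ _ (2^-1 ^- 2 * sqnorm B h)).
    apply: sqnorm_le; rewrite ?invr_gt0// => v; rewrite vE.
    have := posdef_ge0 v pA; have := posdef_ge0 v pB; nra.
  by rewrite exprVn invrK; lra.
rewrite -[X in X * _]ger0_norm; last lra.
rewrite -sqrtr_sqr -sqrtrM ?sqr_ge0// ler_wsqrtr//.
apply: (le_trans (det_segment_le pA symh t01)).
by rewrite ler_wpM2r ?(ltW (posdef_det pA))// expr2 ler_peMl// (le_trans ler01).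
Qed.
End posdef_theory.

(** * Stability of smooth functions on open subsets of R^n *)

Section smooth.
Variables (R : realType) (n : nat) (W : set 'rV[R]_n).
Hypothesis oW : open W.
Implicit Types f g : 'rV[R]_n -> R.

Definition C1_at (f : 'rV[R]_n -> R) (y : 'rV[R]_n) : Prop :=
  {for y, continuous f} /\ forall i : 'I_n, derivable f y (delta_mx 0 i).

Lemma near_open (P : 'rV[R]_n -> Prop) y :
  (forall z, W z -> P z) -> W y -> \near y, P y.
Proof. by move=> WP Wy; apply: filterS WP _; exact: open_nbhs_nbhs. Qed.

Lemma partials_congr f g s : (forall y, W y -> f y = g y) ->
  forall y, W y -> partials f s y = partials g s y.
Proof.
move=> fg; elim: s => [|i s IH] y Wy /=; first exact: fg.
by apply: near_eq_derive; exact: near_open.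
Qed.

Lemma C1_at_congr f g y : (forall z, W z -> f z = g z) -> W y ->
  C1_at f y -> C1_at g y.
Proof.
move=> fg Wy [cf df]; have nfg : \near y, f y = g y by exact: near_open.
split=> [|i]; last exact: near_eq_derivable (df i).
have cvg_g : g @ y --> f y := cvg_trans (near_eq_cvg nfg) cf.
by rewrite (fg y Wy) in cvg_g; exact: cvg_g.
Qed.

Lemma smooth_on_congr f g : (forall z, W z -> f z = g z) ->
  smooth_on W f -> smooth_on W g.
Proof.
move=> fg sf s y Wy; apply: C1_at_congr Wy (sf s y Wy).
exact: partials_congr.
Qed.

(** A class of C^1 functions that contains the partial derivatives of its
    members consists of smooth functions.  The derivatives need only be in the
    class up to equality on [W]. *)
Lemma smooth_on_coind (S : set ('rV[R]_n -> R)) :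
  (forall f, S f -> forall y, W y -> C1_at f y) ->
  (forall f i, S f -> exists2 g, S g &
    forall y, W y -> 'D_(delta_mx 0 i) f y = g y) ->
  forall f, S f -> smooth_on W f.
Proof.
move=> SC SD f Sf s; elim/last_ind: s f Sf => [|s i IH] f Sf y Wy.
  exact: SC.
rewrite /partials foldr_rcons -/(partials _ s).
have [g Sg fg] := SD f i Sf.
apply: C1_at_congr Wy (IH g Sg y Wy) => z Wz.
by apply: partials_congr => // u /fg.
Qed.

Lemma smooth_on_partial f i : smooth_on W f -> smooth_on W ('D_(delta_mx 0 i) f).
Proof.
by move=> sf s y Wy; have := sf (rcons s i) y Wy; rewrite /partials foldr_rcons.
Qed.

(** The ring expressions with inverses in smooth functions.  Calculus rules turn
    the partial derivative of such an expression into another one, which is what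
    the coinduction principle asks for: all operations and all orders of
    differentiation are treated at once. *)
Inductive smooth_expr : ('rV[R]_n -> R) -> Prop :=
| SmoothAtom f : smooth_on W f -> smooth_expr f
| SmoothCst c : smooth_expr (cst c)
| SmoothAdd f g : smooth_expr f -> smooth_expr g -> smooth_expr (f + g)
| SmoothMul f g : smooth_expr f -> smooth_expr g -> smooth_expr (f * g)
| SmoothInv f : (forall y, W y -> f y != 0) -> smooth_expr f ->
    smooth_expr (fun y => (f y)^-1).

Lemma smooth_exprP f : smooth_expr f -> smooth_on W f.
Proof.
have C : forall f, smooth_expr f -> forall y, W y -> C1_at f y.
  move=> {}f; elim=> {f}.
  - by move=> f sf y Wy; exact: (sf [::] y Wy).
  - by move=> c y Wy; split=> [|i]; [exact: cst_continuous|exact: derivable_cst].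
  - move=> f g _ Cf _ Cg y Wy; have [cf df] := Cf y Wy; have [cg dg] := Cg y Wy.
    by split=> [|i]; [exact: continuousD|exact: derivableD].
  - move=> f g _ Cf _ Cg y Wy; have [cf df] := Cf y Wy; have [cg dg] := Cg y Wy.
    by split=> [|i]; [exact: continuousM|exact: derivableM].
  - move=> f f0 _ Cf y Wy; have [cf df] := Cf y Wy; have f0y := f0 y Wy.
    by split=> [|i]; [exact: continuousV|exact: derivableV].
apply: (smooth_on_coind (S := smooth_expr) C) => {}f i; elim=> {f}.
- move=> f sf; exists ('D_(delta_mx 0 i) f) => //.
  exact/SmoothAtom/smooth_on_partial.
- move=> c; exists (cst 0); first exact: SmoothCst.
  by move=> y _; rewrite derive_cst.
- move=> f g sf [f' sf' ff'] sg [g' sg' gg'].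
  exists (f' + g'); first exact: SmoothAdd.
  move=> y Wy; rewrite deriveD ?ff' ?gg'//; first exact: (C _ sf y Wy).2.
  exact: (C _ sg y Wy).2.
- move=> f g sf [f' sf' ff'] sg [g' sg' gg'].
  exists (f * g' + g * f'); first by apply: SmoothAdd; exact: SmoothMul.
  move=> y Wy; rewrite deriveM ?ff' ?gg'//; first exact: (C _ sf y Wy).2.
  exact: (C _ sg y Wy).2.
- move=> f f0 sf [f' sf' ff'].
  pose v := fun y => (f y)^-1.
  have sv : smooth_expr v by exact: SmoothInv.
  exists (cst (-1) * (v * v) * f').
    by do !apply: SmoothMul => //; exact: SmoothCst.
  move=> y Wy; rewrite deriveV ?ff' ?f0//; last exact: (C _ sf y Wy).2.
  by rewrite /v /= -exprVn mulN1r expr2.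
Qed.

Lemma smooth_on_cst c : smooth_on W (fun=> c).
Proof. exact/smooth_exprP/SmoothCst. Qed.

Lemma smooth_onD f g : smooth_on W f -> smooth_on W g ->
  smooth_on W (fun y => f y + g y).
Proof. by move=> sf sg; apply/smooth_exprP/SmoothAdd; exact: SmoothAtom. Qed.

Lemma smooth_onM f g : smooth_on W f -> smooth_on W g ->
  smooth_on W (fun y => f y * g y).
Proof. by move=> sf sg; apply/smooth_exprP/SmoothMul; exact: SmoothAtom. Qed.

Lemma smooth_onV f : (forall y, W y -> f y != 0) -> smooth_on W f ->
  smooth_on W (fun y => (f y)^-1).
Proof. by move=> f0 sf; apply/smooth_exprP/SmoothInv => //; exact: SmoothAtom. Qed.

Lemma smooth_on_sum (I : Type) (r : seq I) (P : pred I) (F : I -> 'rV[R]_n -> R) :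
  (forall i, smooth_on W (F i)) ->
  smooth_on W (fun y => \sum_(i <- r | P i) F i y).
Proof.
move=> sF; elim: r => [|i r IH].
  by apply: smooth_on_congr (smooth_on_cst 0) => y _; rewrite big_nil.
case Pi: (P i); last by apply: smooth_on_congr IH => y _; rewrite big_cons Pi.
by apply: smooth_on_congr (smooth_onD (sF i) IH) => y _; rewrite big_cons Pi.
Qed.

Lemma smooth_on_prod (I : Type) (r : seq I) (P : pred I) (F : I -> 'rV[R]_n -> R) :
  (forall i, smooth_on W (F i)) ->
  smooth_on W (fun y => \prod_(i <- r | P i) F i y).
Proof.
move=> sF; elim: r => [|i r IH].
  by apply: smooth_on_congr (smooth_on_cst 1) => y _; rewrite big_nil.
case Pi: (P i); last by apply: smooth_on_congr IH => y _; rewrite big_cons Pi.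
by apply: smooth_on_congr (smooth_onM (sF i) IH) => y _; rewrite big_cons Pi.
Qed.

Lemma smooth_onX f k : smooth_on W f -> smooth_on W (fun y => f y ^+ k).
Proof.
move=> sf; apply: smooth_on_congr (smooth_on_prod (index_enum 'I_k) predT (fun=> sf)).
by move=> y _; rewrite prodr_const card_ord.
Qed.

Definition smooth_mx (p q : nat) (A : 'rV[R]_n -> 'M[R]_(p, q)) : Prop :=
  forall a b, smooth_on W (fun y => A y a b).

Lemma smooth_mulmx p q r (A : 'rV[R]_n -> 'M[R]_(p, q))
    (B : 'rV[R]_n -> 'M[R]_(q, r)) :
  smooth_mx A -> smooth_mx B -> smooth_mx (fun y => A y *m B y).
Proof.
move=> sA sB a b; under eq_fun do rewrite mxE.
by apply: smooth_on_sum => j; exact: smooth_onM.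
Qed.

Lemma smooth_det p (A : 'rV[R]_n -> 'M[R]_p) :
  smooth_mx A -> smooth_on W (fun y => \det (A y)).
Proof.
move=> sA; apply: smooth_on_sum => s.
by apply: smooth_onM; [exact: smooth_on_cst|exact: smooth_on_prod].
Qed.

Lemma smooth_trace p (A : 'rV[R]_n -> 'M[R]_p) :
  smooth_mx A -> smooth_on W (fun y => \tr (A y)).
Proof. by move=> sA; exact: smooth_on_sum. Qed.

Lemma smooth_invmx p (A : 'rV[R]_n -> 'M[R]_p) :
  (forall y, W y -> A y \in unitmx) -> smooth_mx A ->
  smooth_mx (fun y => invmx (A y)).
Proof.
move=> uA sA a b.
apply: (@smooth_on_congr (fun y => (\det (A y))^-1 * cofactor (A y) b a)).
  by move=> y Wy; rewrite /invmx uA// !mxE.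
apply: smooth_onM.
  by apply: smooth_onV => [y /uA|]; [rewrite unitmxE unitfE|exact: smooth_det].
apply: smooth_onM; first exact: smooth_on_cst.
apply: smooth_det => c d; under eq_fun do rewrite !mxE; exact: sA.
Qed.

Lemma partials_sum m (c : 'I_m -> R) (F : 'I_m -> 'rV[R]_n -> R) s :
  (forall j, smooth_on W (F j)) -> forall y, W y ->
  partials (fun y => \sum_j c j * F j y) s y =
  \sum_j c j * partials (F j) s y.
Proof.
move=> sF; elim: s => [//|i s IH] y Wy /=.
rewrite (near_eq_derive _ (near_open IH Wy)).
have -> : (fun y => \sum_j c j * partials (F j) s y) =
          \sum_j (c j *: partials (F j) s).
  by apply/funext => z; rewrite fct_sumE.
have dF j := (sF j s y Wy).2 i.
rewrite derive_sum; last by move=> j; exact: derivableZ.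
by apply: eq_bigr => j _; rewrite deriveZ.
Qed.

End smooth.

(** * Energies, lengths and convergence of tensor fields *)

Section integral.
Import HBNNSimple.

(** The integral of [f] is at most the supremum of the integrals of the simple
    functions below its positive part, and dividing such a simple function by [c]
    gives one below [g] extended by 0 off [E]. *)
Lemma integral_le_scaled d (T : measurableType d) (R : realType)
    (mu : {measure set T -> \bar R}) (D E : set T) (f g : T -> \bar R) (c : R) :
  0 < c -> (forall x, E x -> 0 <= g x)%E ->
  (forall x, D x -> E x -> f x <= c%:E * g x)%E ->
  (forall x, D x -> ~ E x -> f x <= 0)%E ->
  (\int[mu]_(x in D) f x <= c%:E * \int[mu]_(x in E) g x)%E.
Proof.
move=> c0 g0 fg f0; rewrite [in leRHS]ge0_integralE//.
set G := g \_ E; rewrite -lee_pdivrMl// lee_pdivrMl//.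
rewrite /integral; set F := (f \_ D)^\+%E.
have FG x : (F x <= c%:E * G x)%E.
  have G0 : (0 <= G x)%E.
    by rewrite /G /patch; case: ifPn => // /set_mem; exact: g0.
  rewrite /F funeposE ge_max mule_ge0 ?lee_fin ?(ltW c0)// andbT.
  rewrite {1}/patch; case: ifPn => [/set_mem Dx|_]; last first.
    by rewrite mule_ge0 ?lee_fin ?(ltW c0).
  rewrite /G /patch; case: ifPn => [/set_mem Ex|/negP Ex]; first exact: fg.
  by rewrite mule0; apply: f0 => // /mem_set.
rewrite -[leRHS]sube0; apply: leeB; last first.
  apply: ereal_sup_ubound; exists nnsfun0; last exact: sintegral0.
  by move=> x; exact: funeneg_ge0.
apply: ge_ereal_sup => _ [h hF <-].
have ci0 : 0 <= c^-1 by rewrite invr_ge0 ltW.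
rewrite -lee_pdivrMl// -sintegralrM.
apply: ereal_sup_ubound; exists (scale_nnsfun h ci0) => //= x.
by rewrite EFinM lee_pdivrMl//; exact: le_trans (hF x) (FG x).
Qed.

End integral.

Lemma cvg_fun_sum (R : realType) (T I : Type) (F : set_system T) (FF : Filter F)
    (r : seq I) (f : I -> T -> R) (l : I -> R) :
  (forall i, f i @ F --> l i) ->
  (fun t => \sum_(i <- r) f i t) @ F --> \sum_(i <- r) l i.
Proof.
move=> fl; elim: r => [|i r IH].
  rewrite big_nil (_ : (fun t => _) = cst 0); first exact: cvg_cst.
  by apply/funext => t; rewrite big_nil.
rewrite big_cons (_ : (fun t => _) = (fun t => f i t + \sum_(j <- r) f j t)).
  exact: cvgD.
by apply/funext => t; rewrite big_cons.
Qed.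

Section geom.
Variables (R : realType) (n : nat) (M : closed_manifold R n).
Implicit Types g h : field M.
Local Notation chart i := (atlas M i).

Lemma ccodomP i y : ccodom (chart i) y ->
  exists2 x, cdom (chart i) x & cinv (chart i) y = x /\ y = cmap (chart i) x.
Proof. by move=> [x dx <-]; exists x => //; rewrite cmapK. Qed.

Lemma ccodom_cdom i y : ccodom (chart i) y -> cdom (chart i) (cinv (chart i) y).
Proof. by move=> /ccodomP[x dx [-> _]]. Qed.

Lemma open_ccodom i : open (ccodom (chart i)).
Proof. exact: ccodom_open. Qed.

Lemma Vol_ge0 (Y : set M) g : (0 <= Vol Y g)%E.
Proof.
apply: sume_ge0 => i _; apply: integral_ge0 => t _.
by rewrite lee_fin /= mul1r sqrtr_ge0.
Qed.

Lemma Vol_mono (Y : set M) g : (Vol Y g <= Vol setT g)%E.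
Proof.
apply: lee_sum => i _; rewrite -[leRHS]mul1e; apply: integral_le_scaled => //.
- by move=> t _; rewrite lee_fin /= mul1r sqrtr_ge0.
- by move=> t _ _; rewrite mul1e.
- by move=> t [x [Yx px] xt] []; exists x.
Qed.
(** The energy of a velocity supported in [E] is controlled by the volume of [E]
    for any reference metric, through a comparison of densities. *)
Lemma L2_le g h g' (E : set M) (c : R) : 0 < c ->
  (forall i x, cdom (chart i) x -> E x ->
    sqnorm (g i x) (h i x) * Num.sqrt (\det (g i x)) <=
    c * Num.sqrt (\det (g' i x))) ->
  (forall i x, cdom (chart i) x -> ~ E x ->
    sqnorm (g i x) (h i x) * Num.sqrt (\det (g i x)) <= 0) ->
  (L2 g h h <= c%:E * Vol E g')%E.
Proof.
move=> c0 hE hNE; rewrite /L2 /Vol /integral_vol ge0_sume_distrr; last first.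
  by move=> i _; apply: integral_ge0 => t _; rewrite lee_fin /= mul1r sqrtr_ge0.
apply: lee_sum => i _; apply: integral_le_scaled => //.
- move=> t [x [_ [dx _]] xt] [z [Ez [dz _]] zt]; rewrite /= -EFinM lee_fin mul1r.
  rewrite -xt cmapK//; apply: hE => //.
  by rewrite -(cmapK dx) xt -zt cmapK.
- move=> t [x [_ [dx dNx]] xt] nE; rewrite lee_fin -xt /= cmapK//.
  by apply: hNE => // Ex; apply: nE; exists x.
Qed.

Lemma length_C1_le (a b : R) (gamma gamma' : R -> field M) (V : \bar R) (c : R) :
  a <= b -> 0 <= c -> (0 <= V)%E ->
  (forall t, t \in `[a, b] -> (L2 (gamma t) (gamma' t) (gamma' t) <=
     (c ^+ 2)%:E * V)%E) ->
  (length_C1 a b gamma gamma' <= ((b - a) * c)%:E * sqrte V)%E.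
Proof.
move=> ab c0 V0 L2V; rewrite /length_C1.
apply: (@le_trans _ _ (1%:E * \int[lebesgue_measure]_(t in `[a, b])
    cst (c%:E * sqrte V) t)%E).
  apply: integral_le_scaled => //.
  - by move=> t _; rewrite mule_ge0 ?sqrte_ge0.
  - move=> t tab _; rewrite mul1e /=.
    have := L2V t tab; rewrite -lee_sqrt ?mule_ge0 ?lee_fin ?sqr_ge0//.
    by rewrite sqrteM ?lee_fin ?sqr_ge0//= sqrtr_sqr ger0_norm.
rewrite mul1e integral_cst//= lebesgue_measure_itv/= lte_fin.
move: ab; rewrite le_eqVlt => /predU1P[->|ab].
  by rewrite ltxx mule0 subrr mul0r mul0e.
by rewrite ab -EFinB muleC muleA -EFinM.
Qed.

(** Convergence in the Frechet space reduces to that of the coefficients because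
    each partial derivative of each [H j] is bounded on compact sets. *)
Lemma cvg_field_lincomb (T : Type) (F : set_system T) (FF : Filter F) m
    (c : 'I_m -> T -> R) (l : 'I_m -> R) (H : 'I_m -> field M) :
  (forall j i a b, smooth_on (ccodom (chart i)) (component (H j) i a b)) ->
  (forall j, c j @ F --> l j) ->
  cvg_field F (fun t i x => \sum_j c j t *: H j i x)
              (fun i x => \sum_j l j *: H j i x).
Proof.
move=> sH cl i a b s K e cK KW e0.
pose D j := partials (component (H j) i a b) s.
have DE (k : 'I_m -> R) y : K y ->
    partials (component (fun i x => \sum_j k j *: H j i x) i a b) s y =
    \sum_j k j * D j y.
  move=> /KW Wy; rewrite -(partials_sum (@open_ccodom i))//.
  congr (partials _ s y); apply/funext => z; rewrite /component summxE.
  by apply: eq_bigr => j _; rewrite mxE.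
have : forall j, exists B : R, forall y, K y -> `|D j y| <= B.
  move=> j; have : compact (D j @` K).
    apply: continuous_compact => //; apply: continuous_in_subspaceT => y.
    by rewrite inE => /KW Wy; exact: (sH j i a b s y Wy).1.
  move=> /compact_bounded[r [_ rB]]; exists (r + 1) => y Ky.
  by apply: (rB (r + 1)); [rewrite ltrDl|exists y].
move=> /choice[B DB].
have /cvgr0_norm_lt/(_ _ e0) :
    (fun t => \sum_j `|c j t - l j| * B j) @ F --> (0 : R).
  rewrite -[X in _ --> X](_ : \sum_j `|l j - l j| * B j = 0); last first.
    by rewrite big1// => j _; rewrite subrr normr0 mul0r.
  apply: cvg_fun_sum => j.
  have cB : (fun t => c j t - l j) @ F --> l j - l j.
    exact: (cvgB (g := cst (l j)) (cl j) (cvg_cst _)).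
  exact: (cvgMr_tmp (b := B j) (cvg_norm cB)).
apply: filterS => t te y Ky.
rewrite !DE// -sumrB; under eq_bigr do rewrite -mulrBl.
apply: le_lt_trans te; apply: le_trans (ler_norm_sum _ _ _) _.
apply: le_trans (ler_norm _); apply: ler_sum => j _.
by rewrite normrM ler_wpM2l// DB.
Qed.

End geom.

(** * Smooth functions, tensor fields and polynomial paths on a closed manifold *)

Section fields.
Variables (R : realType) (n : nat) (M : closed_manifold R n).
Local Notation chart i := (atlas M i).
Implicit Types (f : 'I_(atlas_size M) -> M -> R) (g h : field M).

Lemma metric_posdef g i x : metric g -> cdom (chart i) x -> posdef (g i x).
Proof. by move=> [[symg _ _] posg] dx; split; [exact: symg|exact: posg]. Qed.

(** Given, like a tensor field, by one expression per chart. *)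
Definition smooth_function f : Prop :=
  (forall i j x, cdom (chart i) x -> cdom (chart j) x -> f i x = f j x) /\
  forall i, smooth_on (ccodom (chart i)) (fun y => f i (cinv (chart i) y)).

Lemma smooth_function_cst c : smooth_function (fun _ _ => c).
Proof. by split=> // i; exact/smooth_on_cst/open_ccodom. Qed.

Lemma smooth_functionD f1 f2 : smooth_function f1 -> smooth_function f2 ->
  smooth_function (fun i x => f1 i x + f2 i x).
Proof.
move=> [c1 s1] [c2 s2]; split=> [i j x di dj|i].
  by rewrite (c1 i j x) ?(c2 i j x).
by apply: smooth_onD; [exact: open_ccodom|exact: s1|exact: s2].
Qed.

Lemma smooth_functionM f1 f2 : smooth_function f1 -> smooth_function f2 ->
  smooth_function (fun i x => f1 i x * f2 i x).
Proof.
move=> [c1 s1] [c2 s2]; split=> [i j x di dj|i].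
  by rewrite (c1 i j x) ?(c2 i j x).
by apply: smooth_onM; [exact: open_ccodom|exact: s1|exact: s2].
Qed.

Lemma smooth_functionX f k : smooth_function f ->
  smooth_function (fun i x => f i x ^+ k).
Proof.
move=> [c s]; split=> [i j x di dj|i]; first by rewrite (c i j x).
by apply: smooth_onX; [exact: open_ccodom|exact: s].
Qed.

Lemma smooth_functionV f : (forall i x, cdom (chart i) x -> f i x != 0) ->
  smooth_function f -> smooth_function (fun i x => (f i x)^-1).
Proof.
move=> f0 [c s]; split=> [i j x di dj|i]; first by rewrite (c i j x).
apply: smooth_onV; [exact: open_ccodom|move=> y /ccodom_cdom; exact: f0|exact: s].
Qed.

(** On an overlap of two charts the Jacobian is invertible because it relates
    two invertible matrices of the metric. *)
Lemma smooth_function_sqnorm g h : metric g -> sym_tensor h ->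
  smooth_function (fun i x => sqnorm (g i x) (h i x)).
Proof.
move=> mg [_ ch sh]; have [[_ cg sg] _] := mg; split=> [i j x di dj|i].
  have := cg i j x di dj; have := ch i j x di dj.
  set J := jacobian _ _ => /= -> gE; rewrite gE sqnorm_congr//.
    have := posdef_unit (metric_posdef mg di).
    by rewrite gE !unitmx_mul -andbA => /and3P[].
  exact: posdef_unit (metric_posdef mg dj).
have oW := @open_ccodom _ _ M i.
have sgi : smooth_mx (ccodom (chart i)) (fun y => g i (cinv (chart i) y)).
  by move=> a b; exact: sg.
have shi : smooth_mx (ccodom (chart i)) (fun y => h i (cinv (chart i) y)).
  by move=> a b; exact: sh.
have sVi : smooth_mx (ccodom (chart i)) (fun y => invmx (g i (cinv (chart i) y))).
  apply: smooth_invmx => // y /ccodom_cdom dy.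
  exact: posdef_unit (metric_posdef mg dy).
pose sVhi := smooth_mulmx oW sVi shi.
exact: (smooth_trace oW (smooth_mulmx oW (smooth_mulmx oW sVhi sVi) shi)).
Qed.

Lemma sym_tensorZ f h : smooth_function f -> sym_tensor h ->
  sym_tensor (fun i x => f i x *: h i x).
Proof.
move=> [cf sf] [symh ch sh]; split=> [i x dx|i j x di dj /=|i a b].
- by rewrite linearZ/= symh.
- by rewrite (cf i j x)// {1}(ch i j x)// -scalemxAr -scalemxAl.
- have oW := @open_ccodom _ _ M i.
  apply: smooth_on_congr (smooth_onM oW (sf i) (sh i a b)) => // y _.
  by rewrite /component mxE.
Qed.

Lemma sym_tensorD h1 h2 : sym_tensor h1 -> sym_tensor h2 ->
  sym_tensor (fun i x => h1 i x + h2 i x).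
Proof.
move=> [sym1 c1 s1] [sym2 c2 s2]; split=> [i x dx|i j x di dj /=|i a b].
- by rewrite linearD/= sym1// sym2.
- by rewrite {1}(c1 i j x)// {1}(c2 i j x)// mulmxDr mulmxDl.
- have oW := @open_ccodom _ _ M i.
  apply: smooth_on_congr (smooth_onD oW (s1 i a b) (s2 i a b)) => // y _.
  by rewrite /component mxE.
Qed.

Lemma sym_tensor0 : sym_tensor ((fun _ _ => 0) : field M).
Proof.
split=> [i x _|i j x _ _ /=|i a b]; first by rewrite trmx0.
  by rewrite mulmx0 mul0mx.
have oW := @open_ccodom _ _ M i.
by apply: smooth_on_congr (smooth_on_cst oW 0) => // y _; rewrite /component mxE.
Qed.

Lemma sym_tensor_lincomb m (c : 'I_m -> R) (H : 'I_m -> field M) :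
  (forall j, sym_tensor (H j)) -> sym_tensor (fun i x => \sum_j c j *: H j i x).
Proof.
move=> sH; elim: (index_enum _) => [|j r IH].
  rewrite (_ : (fun i x => _) = fun _ _ => 0); first exact: sym_tensor0.
  by apply/funext => i; apply/funext => x; rewrite big_nil.
rewrite (_ : (fun i x => _) =
  fun i x => c j *: H j i x + \sum_(k <- r) c k *: H k i x).
  exact: (sym_tensorD (sym_tensorZ (smooth_function_cst (c j)) (sH j)) IH).
by apply/funext => i; apply/funext => x; rewrite big_cons.
Qed.

Lemma sym_tensorB h1 h2 : sym_tensor h1 -> sym_tensor h2 ->
  sym_tensor (fun i x => h1 i x - h2 i x).
Proof.
move=> s1 s2; have := sym_tensorD s1 (sym_tensorZ (smooth_function_cst (-1)) s2).
congr sym_tensor; apply/funext => i; apply/funext => x.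
by rewrite scaleN1r.
Qed.

Lemma cvg_monomial_quotient (D : set R) (t : R) j :
  (u - t)^-1 * (u ^+ j - t ^+ j) @[u --> within D t^'] --> j%:R * t ^+ j.-1.
Proof.
apply: (@cvg_trans _ ((fun u => \sum_(i < j) u ^+ (j.-1 - i) * t ^+ i) @ t^')).
  apply: cvg_trans (cvg_app _ (@cvg_within _ _ _ D)).
  apply: near_eq_cvg; apply: cvg_within; near=> u.
  have ut : u - t != 0 by rewrite subr_eq0; near: u; exact: nbhs_dnbhs_neq.
  by rewrite subrXX mulKf.
apply: (cvg_trans (cvg_app _ (@cvg_within _ _ _ _))).
rewrite (_ : j%:R * t ^+ j.-1 = \sum_(i < j) t ^+ (j.-1 - i) * t ^+ i).
  apply: cvg_fun_sum => i; apply: cvgMr_tmp; exact: exprn_continuous.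
rewrite (eq_bigr (fun=> t ^+ j.-1)) ?sumr_const ?card_ord ?mulr_natl// => i _.
by rewrite -exprD subnK// -ltnS (ltn_predK (ltn_ord i)).
Unshelve. all: by end_near. Qed.

(** Only the values of [gamma] on the interval matter, so that a leg of a
    piecewise path can be treated without leaving the path. *)
Lemma C1_path_poly (a b : R) m (H : 'I_m -> field M) (gamma : R -> field M) :
  (forall j, sym_tensor (H j)) ->
  (forall t, t \in `[a, b] -> gamma t = fun i x => \sum_(j < m) t ^+ j *: H j i x) ->
  (forall t, t \in `[a, b] -> metric (gamma t)) ->
  C1_path a b gamma (fun t i x => \sum_(j < m) (j%:R * t ^+ j.-1) *: H j i x).
Proof.
move=> sH gammaE mgamma t tab.
have sHc j i a' b' : smooth_on (ccodom (chart i)) (component (H j) i a' b').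
  by have [_ _] := sH j; apply.
split; [exact: mgamma|exact: sym_tensor_lincomb| |].
- have FF : Filter (within `[a, b] t^') by exact: within_filter.
  have := @cvg_field_lincomb _ _ M _ (within `[a, b] t^') FF m
    (fun j u => (u - t)^-1 * (u ^+ j - t ^+ j)) (fun j => j%:R * t ^+ j.-1) H sHc
    (fun j => @cvg_monomial_quotient _ t j).
  move=> cv i a' b' s K e cK KW e0; have {cv} := cv i a' b' s K e cK KW e0.
  have uab : \forall u \near within `[a, b] t^', u \in `[a, b] by exact: withinT.
  move=> close; near=> u => y Ky.
  have uI : u \in `[a, b] by near: u.
  have -> : (fun (i : 'I_(atlas_size M)) (x : M) =>
        (u - t)^-1 *: (gamma u i x - gamma t i x)) =
      fun i (x : M) => \sum_(j < m) ((u - t)^-1 * (u ^+ j - t ^+ j)) *: H j i x.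
    apply/funext => k; apply/funext => x.
    rewrite !gammaE// -sumrB scaler_sumr; apply: eq_bigr => j _.
    by rewrite -scalerBl scalerA.
  by move: y Ky; near: u.
- apply: cvg_field_lincomb => // j; apply: cvgMl_tmp.
  apply: (cvg_trans (cvg_app _ (@cvg_within _ _ _ _))).
  exact: exprn_continuous.
Unshelve. all: by end_near. Qed.
End fields.

(** * Conformal scaling of a metric *)

Section legs.
Variables (R : realType) (n : nat) (M : closed_manifold R n).
Local Notation chart i := (atlas M i).
Implicit Types (f al be rho : 'I_(atlas_size M) -> M -> R) (g h : field M).

Lemma metricZ f g : smooth_function f ->
  (forall i x, cdom (chart i) x -> 0 < f i x) -> metric g ->
  metric (fun i x => f i x *: g i x).
Proof.
move=> sf f0 mg; split; first exact: sym_tensorZ mg.1.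
by move=> i x dx; have [] := posdefZ (f0 i x dx) (metric_posdef mg dx).
Qed.

Lemma metric_segment g0 g1 t : 0 <= t <= 1 -> metric g0 -> metric g1 ->
  metric (fun i x => g0 i x + t *: (g1 i x - g0 i x)).
Proof.
move=> t01 m0 m1; split.
  apply: sym_tensorD m0.1 _; apply: sym_tensorZ; first exact: smooth_function_cst.
  exact: sym_tensorB m1.1 m0.1.
move=> i x dx.
by have [] := posdef_segment t01 (metric_posdef m0 dx) (metric_posdef m1 dx).
Qed.

(** The fourth power makes the path and its energy density polynomial in the
    factor: the square root of the determinant of [p ^ 4 g] is [p ^ (2 n)] times
    that of [g]. *)
Definition scaling_path al be g (t : R) : field M :=
  fun i x => (al i x + t * be i x) ^+ 4 *: g i x.

Definition scaling_speed al be g (t : R) : field M :=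
  fun i x => (4 * (al i x + t * be i x) ^+ 3 * be i x) *: g i x.

Let binom4 (j : 'I_5) (p q : R) := 'C(4, j)%:R * p ^+ (4 - j) * q ^+ j.

Let binom4E (p q t : R) : \sum_(j < 5) t ^+ j * binom4 j p q = (p + t * q) ^+ 4.
Proof.
rewrite exprDn; apply: eq_bigr => j _.
by rewrite /binom4 exprMn -mulr_natl; ring.
Qed.

Let binom4_deriv (p q t : R) :
  \sum_(j < 5) (j%:R * t ^+ j.-1) * binom4 j p q = 4 * (p + t * q) ^+ 3 * q.
Proof.
rewrite /binom4 !big_ord_recl big_ord0 /= /bump /=.
have [-> -> -> ->] :
    [/\ 'C(4, 1) = 4, 'C(4, 2) = 6, 'C(4, 3) = 4 & 'C(4, 4) = 1]%N.
  by [].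
by ring.
Qed.

Lemma scaling_path_C1 (a b : R) al be g (gamma : R -> field M) :
  smooth_function al -> smooth_function be -> metric g ->
  (forall t i x, t \in `[a, b] -> cdom (chart i) x -> 0 < al i x + t * be i x) ->
  (forall t, t \in `[a, b] -> gamma t = scaling_path al be g t) ->
  C1_path a b gamma (scaling_speed al be g).
Proof.
move=> sal sbe mg pos gammaE.
pose H (j : 'I_5) : field M := fun i x => binom4 j (al i x) (be i x) *: g i x.
rewrite (_ : scaling_speed al be g =
    fun t i x => \sum_(j < 5) (j%:R * t ^+ j.-1) *: H j i x); last first.
  apply/funext => t; apply/funext => i; apply/funext => x.
  rewrite /scaling_speed -binom4_deriv scaler_suml; apply: eq_bigr => j _.
  by rewrite /H scalerA.
apply: C1_path_poly.
- move=> j; apply: sym_tensorZ mg.1.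
  do 2?apply: smooth_functionM; last exact: smooth_functionX.
    exact: smooth_function_cst.
  exact: smooth_functionX.
- move=> t /gammaE ->; apply/funext => i; apply/funext => x.
  rewrite /scaling_path -binom4E scaler_suml; apply: eq_bigr => j _.
  by rewrite /H scalerA.
- have slin t :=
    smooth_functionD sal (smooth_functionM (smooth_function_cst M t) sbe).
  move=> t tab; rewrite gammaE//.
  apply: (metricZ (smooth_functionX 4 (slin t)) _ mg) => i x dx.
  by rewrite exprn_gt0// pos.
Qed.

(** The velocity is [4 b / p] times the metric, so the density is
    [16 n b ^ 2 p ^ (2 n - 2)] times that of [g].  The bound uses [n + 1] to stay
    positive in dimension 0, where the density itself vanishes. *)
Lemma scaling_energy_le (g : 'M[R]_n) (p b : R) :
  posdef g -> 0 < p <= 1 -> `|b| <= 3 ->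
  sqnorm (p ^+ 4 *: g) ((4 * p ^+ 3 * b) *: g) *
    Num.sqrt (\det (p ^+ 4 *: g)) <= 144 * n.+1%:R * Num.sqrt (\det g).
Proof.
move=> pg /andP[p0 p1] b3; have ug := posdef_unit pg.
have pn0 : p != 0 by rewrite gt_eqF.
rewrite sqnormZ ?expf_neq0// detZ.
have -> : sqnorm g g = n%:R by rewrite /sqnorm mulmxKV// mulVmx// mxtrace1.
have -> : (p ^+ 4) ^+ n = (p ^+ n.*2) ^+ 2.
  by rewrite -!exprM; congr (p ^+ _); rewrite -muln2 -mulnA mulnC.
rewrite sqrtrM ?sqr_ge0// sqrtr_sqr ger0_norm; last by rewrite exprn_ge0// ltW.
rewrite mulrA ler_wpM2r ?sqrtr_ge0//.
have b9 : b ^+ 2 <= 9.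
  by have := normr_ge0 b; rewrite -[b ^+ 2]real_normK ?num_real//; nra.
have n0 : (0 : R) <= n%:R by [].
case: {g pg ug} n n0 => [|k] k0.
  by rewrite mulr0 mul0r.
have -> : (4 * p ^+ 3 * b / p ^+ 4) ^+ 2 * k.+1%:R * p ^+ k.+1.*2 =
    16 * k.+1%:R * (b ^+ 2 * p ^+ k.*2).
  have -> : p ^+ k.+1.*2 = p ^+ 2 * p ^+ k.*2 by rewrite -exprD.
  move: (p ^+ k.*2) k.+1%:R => z m.
  by field.
have pk1 : p ^+ k.*2 <= 1 by rewrite exprn_ile1// ltW.
have pk0 : 0 <= p ^+ k.*2 by rewrite exprn_ge0// ltW.
have bp : b ^+ 2 * p ^+ k.*2 <= 9 * 1 by rewrite ler_pM// sqr_ge0.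
apply: (@le_trans _ _ (16 * k.+1%:R * (9 * 1))).
  by rewrite ler_wpM2l// mulr_ge0.
by rewrite [k.+2%:R]mulrS; lra.
Qed.

Lemma scaling_length_le (a b : R) al be g (gamma : R -> field M) (E : set M) :
  a <= b -> metric g ->
  (forall t i x, t \in `[a, b] -> cdom (chart i) x ->
     0 < al i x + t * be i x <= 1) ->
  (forall i x, cdom (chart i) x -> `|be i x| <= 3) ->
  (forall i x, cdom (chart i) x -> ~ E x -> be i x = 0) ->
  (forall t, t \in `[a, b] -> gamma t = scaling_path al be g t) ->
  (length_C1 a b gamma (scaling_speed al be g) <=
   ((b - a) * (12 * Num.sqrt n.+1%:R))%:E * sqrte (Vol E g))%E.
Proof.
move=> ab mg p01 be3 be0 gammaE; apply: length_C1_le => //; first exact: Vol_ge0.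
move=> t tab; rewrite gammaE//.
have -> : (12 * Num.sqrt n.+1%:R) ^+ 2 = 144 * n.+1%:R :> R.
  by rewrite exprMn sqr_sqrtr//; ring.
apply: L2_le => [|i x dx Ex|i x dx nEx]; first by rewrite mulr_gt0.
  exact: scaling_energy_le (metric_posdef mg dx) (p01 t i x tab dx) (be3 i x dx).
by rewrite /scaling_speed /sqnorm be0// mulr0 scale0r mulmx0 mxtrace0 mul0r.
Qed.

End legs.

(** * The detour between two metrics *)

Section distance.
Variables (R : realType) (n : nat) (M : closed_manifold R n).
Variables (g0 g1 : field M).
Hypotheses (m0 : metric g0) (m1 : metric g1).
Local Notation chart i := (atlas M i).
Local Notation E := (diff_set g0 g1).

Let h : field M := fun i x => g1 i x - g0 i x.

Let sh : sym_tensor h.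
Proof. exact: sym_tensorB m1.1 m0.1. Qed.

Let h0 i x : cdom (chart i) x -> ~ E x -> h i x = 0.
Proof.
move=> dx nEx; apply/eqP; rewrite subr_eq0; apply/eqP/esym.
by apply: contrapT => g01; apply: nEx; exists i.
Qed.

(** The bound of [segment_energy_le], as a function on the manifold. *)
Definition excess (i : 'I_(atlas_size M)) (x : M) : R :=
  4 * (sqnorm (g0 i x) (h i x) + sqnorm (g1 i x) (h i x)) *
  detbound n (sqnorm (g0 i x) (h i x)).

Let sqnorm0_ge0 i x : cdom (chart i) x -> 0 <= sqnorm (g0 i x) (h i x).
Proof.
move=> dx; apply: sqnorm_ge0; first exact: metric_posdef.
by have [symh _ _] := sh; exact: symh.
Qed.

Let sqnorm1_ge0 i x : cdom (chart i) x -> 0 <= sqnorm (g1 i x) (h i x).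
Proof.
move=> dx; apply: sqnorm_ge0; first exact: metric_posdef.
by have [symh _ _] := sh; exact: symh.
Qed.

Lemma excess_ge0 i x : cdom (chart i) x -> 0 <= excess i x.
Proof.
move=> dx; have s0 := sqnorm0_ge0 dx; have s1 := sqnorm1_ge0 dx.
rewrite mulr_ge0//; first by rewrite mulr_ge0// addr_ge0.
exact: le_trans ler01 (detbound_ge1 _ s0).
Qed.

Lemma excess_eq0 i x : cdom (chart i) x -> ~ E x -> excess i x = 0.
Proof.
move=> dx nEx; rewrite /excess h0// /sqnorm !mulmx0 mxtrace0 addr0.
by rewrite mulr0 mul0r.
Qed.

Lemma smooth_excess : smooth_function excess.
Proof.
have c (r : R) := smooth_function_cst M r.
have s0 := smooth_function_sqnorm m0 sh; have s1 := smooth_function_sqnorm m1 sh.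
apply: (smooth_functionM (smooth_functionM (c 4) (smooth_functionD s0 s1))).
have spow := smooth_functionX n (smooth_functionD (c 2) s0).
exact: (smooth_functionM (c n`!%:R) spow).
Qed.

Let rho i x : R := (1 + excess i x)^-1.

Let rho01 i x : cdom (chart i) x -> 0 < rho i x <= 1.
Proof.
move=> /excess_ge0 e0; rewrite invr_gt0 invf_le1 ?ltr_pwDl//.
by rewrite lerDl e0.
Qed.

Let rho1 i x : cdom (chart i) x -> ~ E x -> rho i x = 1.
Proof. by move=> dx nEx; rewrite /rho excess_eq0// addr0 invr1. Qed.

Let smooth_rho : smooth_function rho.
Proof.
apply: smooth_functionV => [i x /excess_ge0 e0|].
  by rewrite gt_eqF// ltr_pwDl.
exact: (smooth_functionD (smooth_function_cst M 1) smooth_excess).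
Qed.

Let w i x : R := rho i x - 1.

Let smooth_w : smooth_function w.
Proof. exact: (smooth_functionD smooth_rho (smooth_function_cst M (-1))). Qed.

(* The factor [1 + 3 t w] runs from 1 to [rho] on [0, 1/3], and
   [1 + 3 (1 - t) w] from [rho] to 1 on [2/3, 1]. *)
Let al0 (i : 'I_(atlas_size M)) (x : M) : R := 1.
Let be0 i x : R := 3 * w i x.
Let al1 i x : R := 1 + 3 * w i x.
Let be1 i x : R := (-3) * w i x.

Let bridge (t : R) : field M :=
  fun i x => rho i x ^+ 4 *: (g0 i x + (3 * t - 1) *: h i x).

Let bridge_speed (t : R) : field M :=
  fun i x => (3 * rho i x ^+ 4) *: h i x.

(** Each leg takes a third of the unit time, whence the factors 3 in the speeds of
    the affine factors above; the legs agree at the breakpoints as functions,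
    even outside the domains of the charts. *)
Definition detour (t : R) : field M :=
  if t <= 3^-1 then scaling_path al0 be0 g0 t
  else if t <= 2 / 3 then bridge t else scaling_path al1 be1 g1 t.

Let detour_left t : t \in `[0, 3^-1] -> detour t = scaling_path al0 be0 g0 t.
Proof. by rewrite in_itv/= /detour => /andP[_ ->]. Qed.

Let detour_mid t : t \in `[3^-1, 2 / 3] -> detour t = bridge t.
Proof.
rewrite in_itv/= /detour => /andP[t1 t2]; rewrite t2; case: ifPn => // t3.
have -> : t = 3^-1 by apply/le_anti/andP.
apply/funext => i; apply/funext => x; rewrite /scaling_path /bridge.
rewrite mulfV// subrr scale0r addr0; congr (_ ^+ 4 *: _).
by rewrite /al0 /be0 /w; field.
Qed.

Let detour_right t : t \in `[2 / 3, 1] -> detour t = scaling_path al1 be1 g1 t.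
Proof.
rewrite in_itv/= /detour => /andP[t1 t2].
have -> : (t <= 3^-1) = false by apply/negbTE; rewrite -ltNge; lra.
case: ifPn => // t3; have -> : t = 2 / 3 by apply/le_anti/andP.
apply/funext => i; apply/funext => x; rewrite /scaling_path /bridge.
have -> : g0 i x + (3 * (2 / 3) - 1) *: h i x = g1 i x.
  rewrite (_ : 3 * (2 / 3) - 1 = 1); last by field.
  by rewrite scale1r /h addrC subrK.
by congr (_ ^+ 4 *: _); rewrite /al1 /be1 /w; field.
Qed.

Let left_range t i x : t \in `[0, 3^-1] -> cdom (chart i) x ->
  0 < al0 i x + t * be0 i x <= 1.
Proof.
rewrite in_itv/= => /andP[t0 t1] /rho01/andP[r0 r1].
by rewrite /al0 /be0 /w; apply/andP; split; nra.
Qed.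

Let right_range t i x : t \in `[2 / 3, 1] -> cdom (chart i) x ->
  0 < al1 i x + t * be1 i x <= 1.
Proof.
rewrite in_itv/= => /andP[t0 t1] /rho01/andP[r0 r1].
by rewrite /al1 /be1 /w; apply/andP; split; nra.
Qed.

Let bridge_metric t : t \in `[3^-1, 2 / 3] -> metric (bridge t).
Proof.
rewrite in_itv/= => /andP[t1 t2].
have t01 : 0 <= 3 * t - 1 <= 1 by lra.
apply: (metricZ (smooth_functionX 4 smooth_rho) _ (metric_segment t01 m0 m1)).
by move=> i x /rho01/andP[r0 _]; rewrite exprn_gt0.
Qed.

Let detour_C1_left : C1_path 0 3^-1 detour (scaling_speed al0 be0 g0).
Proof.
have c (r : R) := smooth_function_cst M r.
have pos t i x tI dx := proj1 (andP (@left_range t i x tI dx)).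
have sbe := smooth_functionM (c 3) smooth_w.
exact: (scaling_path_C1 (c 1) sbe m0 pos detour_left).
Qed.

Let detour_C1_right : C1_path (2 / 3) 1 detour (scaling_speed al1 be1 g1).
Proof.
have c (r : R) := smooth_function_cst M r.
have pos t i x tI dx := proj1 (andP (@right_range t i x tI dx)).
have sal := smooth_functionD (c 1) (smooth_functionM (c 3) smooth_w).
have sbe := smooth_functionM (c (-3)) smooth_w.
exact: (scaling_path_C1 sal sbe m1 pos detour_right).
Qed.

Let detour_C1_mid : C1_path 3^-1 (2 / 3) detour bridge_speed.
Proof.
pose H (j : 'I_2) : field M := fun i x =>
  if j == 0 then rho i x ^+ 4 *: (g0 i x - h i x)
  else (3 * rho i x ^+ 4) *: h i x.
rewrite (_ : bridge_speed =
    fun t i x => \sum_(j < 2) (j%:R * t ^+ j.-1) *: H j i x); last first.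
  apply/funext => t; apply/funext => i; apply/funext => x.
  by rewrite !big_ord_recl big_ord0 /= mul0r scale0r add0r addr0 mul1r scale1r.
have sr4 := smooth_functionX 4 smooth_rho.
apply: C1_path_poly.
- move=> j; rewrite /H; case: (j == 0).
    exact: (sym_tensorZ sr4 (sym_tensorB m0.1 sh)).
  exact: (sym_tensorZ (smooth_functionM (smooth_function_cst M 3) sr4) sh).
- move=> t /detour_mid ->; apply/funext => i; apply/funext => x.
  rewrite !big_ord_recl big_ord0 /= addr0 expr0 scale1r expr1 /bridge /H /=.
  move: (h i x) (g0 i x) (rho i x) => k g r.
  rewrite !scalerDr scalerN !scalerA -addrA -scaleNr -scalerDl.
  by congr (_ + _ *: _); ring.
- by move=> t tI; rewrite (detour_mid tI); exact: bridge_metric.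
Qed.

(** The factor [rho ^ (2 n) <= rho] absorbs the bound [excess], as
    [rho * excess <= 1].  In dimension 0 there is no such factor, but then the
    trace vanishes. *)
Let bridge_energy_le t i x : t \in `[3^-1, 2 / 3] -> cdom (chart i) x ->
  sqnorm (bridge t i x) (bridge_speed t i x) * Num.sqrt (\det (bridge t i x)) <=
  9 * Num.sqrt (\det (g0 i x)).
Proof.
rewrite in_itv/= => /andP[t1 t2] dx.
have t01 : 0 <= 3 * t - 1 <= 1 by lra.
have [p0 p1] := (metric_posdef m0 dx, metric_posdef m1 dx).
have e0 := excess_ge0 dx.
have /andP[r0 r1] := rho01 dx.
have energy := segment_energy_le p0 p1 t01.
have pt := posdef_segment t01 p0 p1.
rewrite -[g1 i x - g0 i x]/(h i x) in energy pt.
rewrite /bridge /bridge_speed sqnormZ ?expf_neq0 ?gt_eqF ?posdef_unit// detZ.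
set A := g0 i x + _ in energy pt *.
have -> : (rho i x ^+ 4) ^+ n = (rho i x ^+ n.*2) ^+ 2.
  by rewrite -!exprM; congr (_ ^+ _); rewrite -muln2 -mulnA mulnC.
rewrite sqrtrM ?sqr_ge0// sqrtr_sqr ger0_norm; last by rewrite exprn_ge0// ltW.
rewrite mulfK ?expf_neq0 ?gt_eqF//.
have sA : 0 <= sqnorm A (h i x).
  by apply: sqnorm_ge0 => //; have [symh _ _] := sh; exact: symh.
have q0 : 0 <= Num.sqrt (\det A) by rewrite sqrtr_ge0.
have -> : 3 ^+ 2 * sqnorm A (h i x) * (rho i x ^+ n.*2 * Num.sqrt (\det A)) =
    9 * (rho i x ^+ n.*2 * (sqnorm A (h i x) * Num.sqrt (\det A))) by ring.
rewrite ler_wpM2l//; have [nz|n0] := posnP n.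
  have -> : sqnorm A (h i x) = 0.
    rewrite /sqnorm /mxtrace big1// => k; move: (ltn_ord k).
    by rewrite [X in (_ < X)%N]nz.
  by rewrite mul0r mulr0 sqrtr_ge0.
have rn : rho i x ^+ n.*2 <= rho i x.
  by rewrite -[leRHS]expr1 ler_wiXn2l// ?ltW// double_gt0.
apply: (@le_trans _ _ (rho i x * (sqnorm A (h i x) * Num.sqrt (\det A)))).
  by rewrite ler_wpM2r// mulr_ge0.
apply: (@le_trans _ _ (rho i x * (excess i x * Num.sqrt (\det (g0 i x))))).
  by rewrite ler_wpM2l// ltW.
rewrite mulrA ler_piMl ?sqrtr_ge0// /rho mulrC ler_pdivrMr ?ltr_pwDl//.
by rewrite mul1r lerDr.
Qed.

(** Each scaling leg has length at most [(1/3) 12 sqrt (n + 1) = 4 sqrt (n + 1)]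
    times the root of a volume, and the bridge at most [(1/3) 3 = 1] times. *)
Lemma L2_dist_le :
  (L2_dist g0 g1 <= (4 * Num.sqrt n.+1%:R + 1)%:E *
    (sqrte (Vol E g0) + sqrte (Vol E g1)))%E.
Proof.
pose ts : seq R := [:: 3^-1; 2 / 3; 1].
pose v (k : nat) : R -> field M := nth (scaling_speed al1 be1 g1)
  [:: scaling_speed al0 be0 g0; bridge_speed] k.
have dist_le : (L2_dist g0 g1 <= path_length detour ts v)%E.
  apply: ereal_inf_lbound; exists detour, ts, v; split; last by [].
  - split=> [|//|]; first by rewrite /= !andbT; lra.
    case=> [|[|[|//]]] _; [exact: detour_C1_left|exact: detour_C1_mid|].
    exact: detour_C1_right.
  - rewrite detour_left; last by rewrite in_itv/=; lra.
    apply/funext => i; apply/funext => x.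
    by rewrite /scaling_path mul0r addr0 expr1n scale1r.
  - rewrite detour_right; last by rewrite in_itv/=; lra.
    apply/funext => i; apply/funext => x.
    rewrite /scaling_path (_ : _ + _ = 1) ?expr1n ?scale1r//.
    by rewrite /al1 /be1; ring.
apply: (le_trans dist_le); rewrite /path_length !big_ord_recl big_ord0.
rewrite [X in (_ + (_ + X))%E]adde0 /=.
have wle i x : cdom (chart i) x -> `|w i x| <= 1.
  by move=> /rho01/andP[r0 r1]; rewrite /w ler_norml; lra.
have w0 i x : cdom (chart i) x -> ~ E x -> w i x = 0.
  by move=> dx nEx; rewrite /w rho1// subrr.
have left_le := @scaling_length_le R n M 0 3^-1 al0 be0 g0 detour E.
have right_le := @scaling_length_le R n M (2 / 3) 1 al1 be1 g1 detour E.
have mid_le : (length_C1 3^-1 (2 / 3) detour bridge_speed <=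
    ((2 / 3 - 3^-1) * 3)%:E * sqrte (Vol E g0))%E.
  apply: length_C1_le; [lra|by []|exact: Vol_ge0|].
  move=> t tI; rewrite detour_mid//; apply: L2_le => [//|i x dx _|i x dx nEx].
    by rewrite expr2 (_ : 3 * 3 = 9); [exact: bridge_energy_le|ring].
  by rewrite /bridge_speed h0// scaler0 /sqnorm mulmx0 mxtrace0 mul0r.
set s := Num.sqrt _.
have s0 : 0 <= s by rewrite sqrtr_ge0.
apply: (@le_trans _ _ ((4 * s)%:E * sqrte (Vol E g0) +
    (1%:E * sqrte (Vol E g0) + (4 * s)%:E * sqrte (Vol E g1)))%E).
  apply: leeD; last apply: leeD.
  - rewrite (_ : 4 * s = (3^-1 - 0) * (12 * s)); last by field.
    apply: left_le; [by rewrite invr_ge0|exact: m0|exact: left_range| | |exact: detour_left].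
    + move=> i x dx; rewrite /be0 normrM ger0_norm//.
      by rewrite -[leRHS]mulr1 ler_wpM2l// wle.
    + by move=> i x dx nEx; rewrite /be0 w0// mulr0.
  - by move: mid_le; rewrite (_ : (2 / 3 - 3^-1) * 3 = 1)//; field.
  - rewrite (_ : 4 * s = (1 - 2 / 3) * (12 * s)); last by field.
    apply: right_le; [lra|exact: m1|exact: right_range| | |exact: detour_right].
    + move=> i x dx; rewrite /be1 mulNr normrN normrM ger0_norm//.
      by rewrite -[leRHS]mulr1 ler_wpM2l// wle.
    + by move=> i x dx nEx; rewrite /be1 w0// mulr0.
have q0 (g : field M) : (0 <= sqrte (Vol E g))%E by exact: sqrte_ge0.
rewrite addeA -ge0_muleDl ?lee_fin ?mulr_ge0// -EFinD.
rewrite ge0_muleDr// leeD2l// lee_wpmul2r// lee_fin lerDl ler01.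
by [].
Qed.

End distance.


(** * The bound on the distance and on the diameter *)

Theorem proposition4p1 (R : realType) :
  exists C : nat -> R, forall (n : nat) (M : closed_manifold R n),
    orientable M ->
    (forall g0 g1 : field M, metric g0 -> metric g1 ->
      let E := diff_set g0 g1 in
      (L2_dist g0 g1 <= (C n)%:E * (sqrte (Vol E g0) + sqrte (Vol E g1)))%E) /\
    (forall delta : R, 0 < delta ->
      (diam [set g : field M | metric g /\ (Vol setT g <= delta%:E)%E]
       <= (2 * C n * Num.sqrt delta)%:E)%E).
Proof.
pose C n : R := 4 * Num.sqrt n.+1%:R + 1; exists C => n M _.
split=> [g0 g1 m0 m1 /=|delta d0]; first exact: (L2_dist_le m0 m1).
have C0 : 0 <= C n by rewrite addr_ge0// mulr_ge0// sqrtr_ge0.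
apply: ge_ereal_sup => _ [g0 [g1 [[m0 V0] [m1 V1] ->]]].
apply: (le_trans (L2_dist_le m0 m1)).
have sqrtV (g : field M) Y : (Vol setT g <= delta%:E)%E ->
    (sqrte (Vol Y g) <= (Num.sqrt delta)%:E)%E.
  move=> Vg; have -> : (Num.sqrt delta)%:E = sqrte delta%:E by [].
  rewrite lee_sqrt; last by rewrite lee_fin ltW.
  exact: le_trans (Vol_mono Y g) Vg.
have -> : ((2 * C n * Num.sqrt delta)%:E =
    (C n)%:E * ((Num.sqrt delta)%:E + (Num.sqrt delta)%:E))%E.
  by rewrite -EFinD -EFinM; congr (_%:E); ring.
apply: lee_wpmul2l; first by rewrite lee_fin.
by apply: leeD; exact: sqrtV.
Qed.
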